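(* Suppose a link $L$ is the braid closure $\widehat{w}$ of some $w\in\mathrm{Br}_3$, and let $0\le\theta_1<\theta_2\le\frac{2\pi}{3}$. If $\Delta_L\ne0$, then $\Delta_L$ has at least $$\frac{\theta_2-\theta_1}{2\pi}\,|\#w|-2$$ roots, counted with multiplicity, in the arc $\{e^{i\theta}:\theta_1\le\theta\le\theta_2\}$ of $S^1$ joining $e^{i\theta_1}$ to $e^{i\theta_2}$.
   Context: $\mathrm{Br}_3 = \langle \sigma_1, \sigma_2 \mid \sigma_1\sigma_2\sigma_1 = \sigma_2\sigma_1\sigma_2\rangle$ is the 3-strand braid group, and $\widehat{w}$ is the oriented link in $S^3$ that is the braid closure of $w$. $\#w\in\mathbb{Z}$ is the image of $w$ under the homomorphism $\mathrm{Br}_3\to\mathbb{Z}$ sending $\sigma_1,\sigma_2$ to $1$. The reduced Burau representation $B_t : \mathrm{Br}_3 \to \mathrm{GL}_2(\mathbb{Z}[t^{\pm1}])$ is given by $B_t(\sigma_1) = \begin{pmatrix} -t & 1\\ 0 & 1\end{pmatrix}$, $B_t(\sigma_2) = \begin{pmatrix} 1 & 0 \\ t & -t\end{pmatrix}$. The Alexander polynomial is $\Delta_{\widehat{w}}(t)=\det(B_t(w)-I)/(t^2+t+1)\in\mathbb{Z}[t^{\pm1}]$, well defined up to units $\pm t^k$. *)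

(* Defs.v *)
From HB Require Import structures.
From mathcomp Require Import all_boot all_order all_algebra.
From mathcomp Require Import generic_quotient.
From mathcomp Require Import boolp classical_sets reals trigo.
From mathcomp Require Import complex ring.

Set Implicit Arguments.
Unset Strict Implicit.
Unset Printing Implicit Defensive.

Import Order.TTheory GRing.Theory Num.Theory.
Local Open Scope ring_scope.

(* A letter [(i, e)] is a generator (sigma_1 if [i = false], sigma_2 if
   [i = true]) or, when [e = true], its inverse. *)
Definition br3_letter : Type := (bool * bool)%type.
Definition br3_word : Type := seq br3_letter.

Definition letter_inv (a : br3_letter) : br3_letter := (a.1, ~~ a.2).
Definition word_inv (u : br3_word) : br3_word := [seq letter_inv a | a <- rev u].

Inductive br3_equiv : br3_word -> br3_word -> Prop :=
| br3_refl u : br3_equiv u u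
| br3_sym u v : br3_equiv u v -> br3_equiv v u
| br3_trans u v w : br3_equiv u v -> br3_equiv v w -> br3_equiv u w
| br3_cat u u' v v' :
    br3_equiv u u' -> br3_equiv v v' -> br3_equiv (u ++ v) (u' ++ v')
| br3_cancel a : br3_equiv [:: a; letter_inv a] [::]
| br3_braid :
    br3_equiv [:: (false, false); (true, false); (false, false)]
              [:: (true, false); (false, false); (true, false)].

Definition br3_equivb (u v : br3_word) : bool := `[< br3_equiv u v >].

Lemma br3_equivb_equiv : equiv_class_of br3_equivb.
Proof.
split=> [u|u v|v u w].
- by apply/asboolP; exact: br3_refl.
- by apply/asboolP/asboolP; exact: br3_sym.
- move=> /asboolP uv /asboolP vw; apply/asboolP; exact: br3_trans uv vw.
Qed.

Canonical br3_equiv_rel := EquivRelPack br3_equivb_equiv.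

Definition Br3 : Type := {eq_quot br3_equiv_rel}%qT.
HB.instance Definition _ := Choice.on Br3.

Definition br3_of_word (u : br3_word) : Br3 := (\pi_{eq_quot br3_equiv_rel} u)%qT.
Definition br3_repr (x : Br3) : br3_word :=
  repr (x : {eq_quot br3_equiv_rel}%qT).

Lemma br3_reprK x : br3_of_word (br3_repr x) = x.
Proof. exact: reprK. Qed.

Lemma br3_of_wordP u v : br3_of_word u = br3_of_word v <-> br3_equiv u v.
Proof.
split; first by move/eqquotP => /= /asboolP.
by move=> uv; apply/eqquotP => /=; apply/asboolP.
Qed.

Lemma br3_repr_of_word u : br3_equiv (br3_repr (br3_of_word u)) u.
Proof. by apply/br3_of_wordP; rewrite br3_reprK. Qed.

Lemma letter_invK : involutive letter_inv.
Proof. by case=> i e; rewrite /letter_inv /= negbK. Qed.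

Lemma word_inv_cat u v : word_inv (u ++ v) = word_inv v ++ word_inv u.
Proof. by rewrite /word_inv rev_cat map_cat. Qed.

Lemma word_invK : involutive word_inv.
Proof.
move=> u; rewrite /word_inv -map_rev revK -map_comp map_id_in // => a _ /=.
exact: letter_invK.
Qed.

Lemma br3_word_mulV u : br3_equiv (u ++ word_inv u) [::].
Proof.
elim: u => [|a u IH]; first exact: br3_refl.
rewrite -cat1s word_inv_cat catA -(catA [:: a]).
apply: br3_trans (br3_cancel a); rewrite -[X in br3_equiv _ X]/([:: a] ++ _).
apply: br3_cat (br3_refl _).
by rewrite -{2}[[:: a]]cats0; apply: br3_cat IH; exact: br3_refl.
Qed.

Lemma br3_word_Vmul u : br3_equiv (word_inv u ++ u) [::].
Proof. by rewrite -{2}[u]word_invK; exact: br3_word_mulV. Qed.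

Lemma br3_word_inv u v : br3_equiv u v -> br3_equiv (word_inv u) (word_inv v).
Proof.
move=> uv; apply: (@br3_trans _ (word_inv u ++ (v ++ word_inv v))).
  rewrite -{1}[word_inv u]cats0; apply: br3_cat (br3_refl _) _.
  exact/br3_sym/br3_word_mulV.
rewrite catA -{2}[word_inv v]cat0s; apply: br3_cat _ (br3_refl _).
apply: br3_trans (br3_word_Vmul u); apply: br3_cat (br3_refl _) _.
exact: br3_sym.
Qed.

Definition br3_mul (x y : Br3) : Br3 := br3_of_word (br3_repr x ++ br3_repr y).
Definition br3_one : Br3 := br3_of_word [::].
Definition br3_inv (x : Br3) : Br3 := br3_of_word (word_inv (br3_repr x)).

Lemma br3_of_word_cat u v :
  br3_of_word (u ++ v) = br3_mul (br3_of_word u) (br3_of_word v).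
Proof.
apply/br3_of_wordP/br3_sym.
by apply: br3_cat; exact: br3_repr_of_word.
Qed.

Lemma br3_mulA : associative br3_mul.
Proof.
move=> x y z; rewrite -[x]br3_reprK -[y]br3_reprK -[z]br3_reprK.
by rewrite -!br3_of_word_cat catA.
Qed.

Lemma br3_mul1 : left_id br3_one br3_mul.
Proof. by move=> x; rewrite -[x]br3_reprK -br3_of_word_cat. Qed.

Lemma br3_mulr1 : right_id br3_one br3_mul.
Proof. by move=> x; rewrite -[x]br3_reprK -br3_of_word_cat cats0. Qed.

Lemma br3_mulV : left_inverse br3_one br3_inv br3_mul.
Proof.
move=> x; rewrite -{2}[x]br3_reprK -br3_of_word_cat.
exact/br3_of_wordP/br3_word_Vmul.
Qed.

Lemma br3_mulrV : right_inverse br3_one br3_inv br3_mul.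
Proof.
move=> x; rewrite -{1}[x]br3_reprK -br3_of_word_cat.
exact/br3_of_wordP/br3_word_mulV.
Qed.

HB.instance Definition _ :=
  isGroup.Build Br3 br3_mulA br3_mul1 br3_mulr1 br3_mulV br3_mulrV.

Lemma br3_of_wordM u v :
  br3_of_word (u ++ v) = (br3_of_word u * br3_of_word v)%g.
Proof. exact: br3_of_word_cat. Qed.

Definition sigma1 : Br3 := br3_of_word [:: (false, false)].
Definition sigma2 : Br3 := br3_of_word [:: (true, false)].

Lemma braid_relation :
  (sigma1 * sigma2 * sigma1 = sigma2 * sigma1 * sigma2)%g.
Proof.
rewrite /sigma1 /sigma2 -!br3_of_wordM.
exact/br3_of_wordP/br3_braid.
Qed.

Definition word_expsum (u : br3_word) : int :=
  \sum_(a <- u) (-1) ^+ a.2.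

Definition expsum (w : Br3) : int := word_expsum (br3_repr w).

Lemma word_expsum_equiv u v : br3_equiv u v -> word_expsum u = word_expsum v.
Proof.
rewrite /word_expsum; elim=> {u v} [//|//||||].
- by move=> u v w _ -> _ ->.
- by move=> u u' v v' _ eu _ ev; rewrite !big_cat /= eu ev.
- by case=> i [] /=; rewrite !(big_cons, big_nil).
- by rewrite !(big_cons, big_nil).
Qed.

Lemma expsum_of_word u : expsum (br3_of_word u) = word_expsum u.
Proof. exact/word_expsum_equiv/br3_repr_of_word. Qed.

Lemma expsumM x y : expsum (x * y)%g = expsum x + expsum y.
Proof. by rewrite expsum_of_word /word_expsum big_cat. Qed.

Lemma expsum_sigma1 : expsum sigma1 = 1.
Proof. by rewrite expsum_of_word /word_expsum big_seq1. Qed.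

Lemma expsum_sigma2 : expsum sigma2 = 1.
Proof. by rewrite expsum_of_word /word_expsum big_seq1. Qed.

(* Z[t, 1/t] is realized as the subring [laurent] of the field Q(t). *)
Definition fracX : {fraction {poly int}} := tofrac 'X.

Definition laurent_pred : {pred {fraction {poly int}}} :=
  [pred f | `[< exists n (p : {poly int}), f * fracX ^+ n = tofrac p >]].

Lemma fracX_neq0 : fracX != 0.
Proof. by rewrite tofrac_eq0 polyX_eq0. Qed.

Lemma laurent_subring : subring_closed laurent_pred.
Proof.
split=> [|f g|f g].
- apply/asboolP; exists 0%N, 1; by rewrite tofrac1 mulr1.
- move=> /asboolP [n [p fp]] /asboolP [m [q gq]]; apply/asboolP.
  exists (n + m)%N, (p * 'X^m - q * 'X^n).
  rewrite tofracB !tofracM !tofracXn -fp -gq mulrBl exprD mulrA.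
  by rewrite (mulrC (fracX ^+ n)) mulrA.
- move=> /asboolP [n [p fp]] /asboolP [m [q gq]]; apply/asboolP.
  exists (n + m)%N, (p * q).
  by rewrite tofracM -fp -gq exprD mulrACA.
Qed.

HB.instance Definition _ :=
  GRing.isSubringClosed.Build {fraction {poly int}} laurent_pred laurent_subring.

Record laurent : Type := Laurent {
  laurent_val :> {fraction {poly int}};
  laurent_valP : laurent_val \in laurent_pred }.

HB.instance Definition _ := [isSub for laurent_val].
HB.instance Definition _ := [Choice of laurent by <:].
HB.instance Definition _ := [SubChoice_isSubComNzRing of laurent by <:].

Definition laurent_unit : {pred laurent} :=
  [pred f : laurent | (val f != 0) && ((val f)^-1 \in laurent_pred)].

Definition laurent_inv (f : laurent) : laurent := insubd f (val f)^-1.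

Lemma laurent_mulVf : {in laurent_unit, left_inverse 1 laurent_inv *%R}.
Proof.
move=> f /andP [f0 fV]; apply: val_inj.
by rewrite rmorphM rmorph1 /= /laurent_inv /insubd insubT /= mulVf.
Qed.

Lemma laurent_unitP (f g : laurent) : g * f = 1 -> laurent_unit f.
Proof.
move=> /(congr1 val); rewrite rmorphM rmorph1 /= => gf1.
have f0 : laurent_val f != 0.
  by apply: contra_eq_neq gf1 => ->; rewrite mulr0 eq_sym oner_neq0.
rewrite /laurent_unit /= f0 /=.
suff -> : (laurent_val f)^-1 = laurent_val g by exact: laurent_valP.
by apply: (mulIf f0); rewrite mulVf // gf1.
Qed.

Lemma laurent_inv_out : {in [predC laurent_unit], laurent_inv =1 id}.
Proof.
move=> f; rewrite inE /laurent_unit => /=.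
rewrite unfold_in /= negb_and negbK => /orP [/eqP f0|fV].
  by apply: val_inj; rewrite /laurent_inv val_insubd /= f0 invr0; case: ifP.
by apply: val_inj; rewrite /laurent_inv val_insubd (negPf fV).
Qed.

HB.instance Definition _ := GRing.ComNzRing_hasMulInverse.Build laurent
  laurent_mulVf laurent_unitP laurent_inv_out.

HB.instance Definition _ :=
  [SubComUnitRing_isSubIntegralDomain of laurent by <:].

Fact laurentX_subproof : fracX \in laurent_pred.
Proof. by apply/asboolP; exists 0%N, 'X; rewrite mulr1. Qed.

Definition laurentX : laurent := Laurent laurentX_subproof.

Lemma laurentX_unit : laurentX \is a GRing.unit.
Proof.
apply/andP; split; first exact: fracX_neq0.
apply/asboolP; exists 1%N, 1; by rewrite expr1 mulVf ?fracX_neq0 ?tofrac1.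
Qed.

Definition mx2 (K : pzRingType) (a b c d : K) : 'M[K]_2 :=
  \matrix_(i < 2, j < 2)
    if i == 0 then (if j == 0 then a else b) else (if j == 0 then c else d).

Definition burau1 : 'M[laurent]_2 := mx2 (- laurentX) 1 0 1.
Definition burau2 : 'M[laurent]_2 := mx2 1 0 laurentX (- laurentX).

Definition burau_letter (a : br3_letter) : 'M[laurent]_2 :=
  let B := if a.1 then burau2 else burau1 in if a.2 then invmx B else B.

Definition word_burau (u : br3_word) : 'M[laurent]_2 :=
  \prod_(a <- u) burau_letter a.

Definition burau (w : Br3) : 'M[laurent]_2 := word_burau (br3_repr w).

Lemma det_mx2 (K : comPzRingType) (a b c d : K) :
  \det (mx2 a b c d) = a * d - b * c.
Proof.
rewrite (expand_det_row _ ord0) big_ord_recl big_ord1 /cofactor !det_mx11.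
by rewrite !mxE /= expr0 expr1 mul1r mulN1r mulrN.
Qed.

Lemma mulmx_mx2 (K : pzRingType) (a b c d a' b' c' d' : K) :
  mx2 a b c d *m mx2 a' b' c' d' =
  mx2 (a * a' + b * c') (a * b' + b * d') (c * a' + d * c') (c * b' + d * d').
Proof.
apply/matrixP => i j; rewrite mxE big_ord_recl big_ord1 !mxE /=.
by case: (i == 0); case: (j == 0).
Qed.

Lemma burau1_unit : burau1 \in unitmx.
Proof. by rewrite unitmxE det_mx2 mulr1 mulr0 subr0 unitrN laurentX_unit. Qed.

Lemma burau2_unit : burau2 \in unitmx.
Proof. by rewrite unitmxE det_mx2 mul1r mul0r subr0 unitrN laurentX_unit. Qed.

Lemma burau_letter_unit a : burau_letter a \in unitmx.
Proof.
by case: a => [[] []]; rewrite /burau_letter /= ?unitmx_inv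
  ?(burau1_unit, burau2_unit).
Qed.

Lemma burau_braid :
  burau1 *m burau2 *m burau1 = burau2 *m burau1 *m burau2.
Proof. by rewrite /burau1 /burau2 !mulmx_mx2; congr mx2; ring. Qed.

Lemma word_burau_equiv u v : br3_equiv u v -> word_burau u = word_burau v.
Proof.
rewrite /word_burau; elim=> {u v} [//|//||||].
- by move=> u v w _ -> _ ->.
- by move=> u u' v v' _ eu _ ev; rewrite !big_cat /= eu ev.
- case=> i []; rewrite !(big_cons, big_nil) mulr1 -mulmxE /burau_letter /=.
  + by case: i; rewrite mulVmx // ?(burau1_unit, burau2_unit).
  + by case: i; rewrite mulmxV // ?(burau1_unit, burau2_unit).
- rewrite !(big_cons, big_nil) !mulr1 -!mulmxE /burau_letter /= !mulmxA.
  exact: burau_braid.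
Qed.

Lemma burau_of_word u : burau (br3_of_word u) = word_burau u.
Proof. exact/word_burau_equiv/br3_repr_of_word. Qed.

Lemma burauM x y : burau (x * y)%g = burau x *m burau y.
Proof. by rewrite burau_of_word /word_burau big_cat. Qed.

Lemma burau_sigma1 : burau sigma1 = burau1.
Proof. by rewrite burau_of_word /word_burau big_seq1. Qed.

Lemma burau_sigma2 : burau sigma2 = burau2.
Proof. by rewrite burau_of_word /word_burau big_seq1. Qed.

Lemma burau_unitmx w : burau w \in unitmx.
Proof.
rewrite /burau /word_burau.
elim/big_rec: _ => [|a B _ BU]; first exact: unitmx1.
by rewrite -mulmxE unitmx_mul BU andbT; exact: burau_letter_unit.
Qed.

(* The quotient is taken in Q(t); it always lies in Z[t, 1/t], so the default
   value 0 is never used, see [alexanderE]. *)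
Definition alexander (w : Br3) : laurent :=
  insubd 0 (val (\det (burau w - 1%:M)) / val (laurentX ^+ 2 + laurentX + 1)).

Definition fixed_vec : 'cV[laurent]_2 := \col_(i < 2) if i == 0 then 1 else 1 + laurentX.

Lemma mx2_fixed a b c d x y :
  a + b * (1 + laurentX) = 1 + (laurentX ^+ 2 + laurentX + 1) * x ->
  c + d * (1 + laurentX) = 1 + laurentX + (laurentX ^+ 2 + laurentX + 1) * y ->
  exists z, mx2 a b c d *m fixed_vec = fixed_vec + (laurentX ^+ 2 + laurentX + 1) *: z.
Proof.
move=> e1 e2; exists (\col_(i < 2) if i == 0 then x else y).
apply/matrixP => i j; rewrite mxE big_ord_recl big_ord1 !mxE /= mulr1.
by case: (i == 0).
Qed.

Lemma burau_letter_fixed a :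
  exists z, burau_letter a *m fixed_vec = fixed_vec + (laurentX ^+ 2 + laurentX + 1) *: z.
Proof.
case: a => i e; rewrite /burau_letter /=.
set B := if i then burau2 else burau1.
have BU : B \in unitmx.
  by rewrite /B; case: i {B}; [exact: burau2_unit | exact: burau1_unit].
have [z Bz] : exists z, B *m fixed_vec = fixed_vec + (laurentX ^+ 2 + laurentX + 1) *: z.
  rewrite /B; case: i {B BU}.
  - by apply: (@mx2_fixed _ _ _ _ 0 (-1)); ring.
  - by apply: (@mx2_fixed _ _ _ _ 0 0); ring.
case: e; last by exists z.
exists (- (invmx B *m z)).
have := congr1 (mulmx (invmx B)) Bz.
rewrite mulmxA mulVmx // mul1mx mulmxDr -scalemxAr => {2}->.
by rewrite scalerN addrK.
Qed.

Lemma burau_fixed w :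
  exists z, burau w *m fixed_vec = fixed_vec + (laurentX ^+ 2 + laurentX + 1) *: z.
Proof.
rewrite /burau /word_burau.
elim/big_rec: _ => [|a B _ [y By]]; first by exists 0; rewrite mul1mx scaler0 addr0.
have [z az] := burau_letter_fixed a.
exists (z + burau_letter a *m y).
rewrite -mulmxE -mulmxA By mulmxDr az -scalemxAr scalerDr.
by rewrite addrA.
Qed.

Lemma cyclotomic3_neq0 : laurentX ^+ 2 + laurentX + 1 != 0.
Proof.
apply/eqP => /(congr1 val).
rewrite !rmorphD rmorphXn rmorph1 rmorph0 /= /fracX.
rewrite -tofracXn -tofracD -tofrac1 -tofracD -tofrac0.
move/eqP; rewrite tofrac_eq => /eqP /(congr1 (fun p : {poly int} => p.[0])).
by rewrite !hornerE.
Qed.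

Lemma alexanderE w :
  alexander w * (laurentX ^+ 2 + laurentX + 1) = \det (burau w - 1%:M).
Proof.
have [z wz] := burau_fixed w.
have Mz : (burau w - 1%:M) *m fixed_vec = (laurentX ^+ 2 + laurentX + 1) *: z.
  by rewrite mulmxBl wz mul1mx addrC addKr.
have [q dq] : exists q, \det (burau w - 1%:M) = q * (laurentX ^+ 2 + laurentX + 1).
  move: (burau w - 1%:M) Mz => M Mz.
  exists (z 0 0 * M 1 1 - M 0 1 * z 1 0).
  have e i : M i 0 + M i 1 * (1 + laurentX) = (laurentX ^+ 2 + laurentX + 1) * z i 0.
    have := congr1 (fun A : 'cV_2 => A i 0) Mz.
    rewrite !mxE big_ord_recl big_ord1 !mxE /= mulr1 => <-.
    by congr (_ + M i _ * _); apply: val_inj.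
  have -> : \det M = M 0 0 * M 1 1 - M 0 1 * M 1 0.
    rewrite -det_mx2; congr (\det _); apply/matrixP => i j; rewrite !mxE.
    by case: i j => [[|[|//]] ?] [[|[|//]] ?] /=; congr (M _ _); apply: val_inj.
  have e0 := e 0; have e1 := e 1.
  have -> : M 0 0 = (laurentX ^+ 2 + laurentX + 1) * z 0 0 - M 0 1 * (1 + laurentX).
    by rewrite -e0 addrK.
  have -> : M 1 0 = (laurentX ^+ 2 + laurentX + 1) * z 1 0 - M 1 1 * (1 + laurentX).
    by rewrite -e1 addrK.
  by ring.
rewrite dq; congr (_ * _); rewrite /alexander dq rmorphM /=.
rewrite mulfK ?valKd //.
have := cyclotomic3_neq0; rewrite -(inj_eq val_inj) rmorph0.
by [].
Qed.

(* [D] is a representative of the Alexander polynomial of the closure of [w],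
   which is defined up to the units (+/-) t^k. *)
Definition is_alexander_of_closure (w : Br3) (D : laurent) : Prop :=
  exists (s : bool) (k : int), D = (-1) ^+ s * laurentX ^ k * alexander w.

Section Roots.
Variable R : realType.

Definition circle_arc (theta1 theta2 : R) : set R[i] :=
  [set (cos theta +i* sin theta)%C | theta in
    [set theta | theta1 <= theta <= theta2]].

(* Roots are repeated according to their multiplicity in the root sequence
   given by [closed_field_poly_normal]. *)
Definition poly_nroots (A : set R[i]) (p : {poly R[i]}) : nat :=
  count (fun z => z \in A) (sval (closed_field_poly_normal p)).

(* Some polynomial equal to [f] up to a power of t. *)
Definition laurent_num (f : laurent) : {poly int} :=
  xget 0 [set p | exists n, val f * fracX ^+ n = tofrac p].

(* A Laurent polynomial is only evaluated away from 0. *)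
Definition laurent_nroots (A : set R[i]) (f : laurent) : nat :=
  poly_nroots (A `\ 0)%classic (map_poly intr (laurent_num f)).

Lemma poly_nrootsE (A : set R[i]) (p : {poly R[i]}) c (rs : seq R[i]) :
  p != 0 -> p = c *: \prod_(z <- rs) ('X - z%:P) ->
  poly_nroots A p = count (fun z => z \in A) rs.
Proof.
rewrite /poly_nroots; case: closed_field_poly_normal => ss /= pE p0 pE'.
have cE : lead_coef p = c.
  by rewrite pE' lead_coefZ (monicP (monic_prod_XsubC _ _ _)) mulr1.
have c0 : c != 0 by rewrite -cE lead_coef_eq0.
apply/permP/prod_XsubC_eq/(scalerI c0).
by rewrite -pE' -cE.
Qed.

(* The choice made in [laurent_num] is irrelevant. *)
Lemma laurent_nrootsE (A : set R[i]) (f : laurent) n (p : {poly int}) :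
  f != 0 -> val f * fracX ^+ n = tofrac p ->
  laurent_nroots A f = poly_nroots (A `\ 0)%classic (map_poly intr p).
Proof.
move=> f0 fp; rewrite /laurent_nroots /laurent_num.
case: xgetP => [q _ [m fq]|/(_ p)]; last by case; exists n.
have vf0 : val f != 0 by rewrite -(inj_eq val_inj) rmorph0 in f0.
have map0 (r : {poly int}) k : val f * fracX ^+ k = tofrac r ->
    map_poly (intr : int -> R[i]) r != 0.
  move=> fr; have r0 : r != 0.
    apply/eqP => r0; move/eqP: fr; rewrite r0 tofrac0 mulf_eq0 (negPf vf0) /=.
    by rewrite expf_eq0 (negPf fracX_neq0) andbF.
  by rewrite map_poly_eq0_id0 // intr_eq0 lead_coef_eq0.
have qp : q * 'X^n = p * 'X^m.
  apply/eqP; rewrite -tofrac_eq !tofracM !tofracXn -fq -fp.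
  by rewrite -/fracX mulrAC.
have := congr1 (map_poly (intr : int -> R[i])) qp.
rewrite !rmorphM /= !map_polyXn.
have := map0 _ _ fp; have := map0 _ _ fq.
move: (map_poly _ p) (map_poly _ q) => P Q Q0 P0 QP.
have [rs PE] := closed_field_poly_normal P.
have [ss QE] := closed_field_poly_normal Q.
rewrite (poly_nrootsE _ P0 PE) (poly_nrootsE _ Q0 QE).
have cE : lead_coef Q = lead_coef P.
  by have := congr1 lead_coef QP; rewrite !lead_coef_Mmonic ?monicXn.
have Xk k : 'X^k = \prod_(z <- nseq k 0) ('X - z%:P) :> {poly R[i]}.
  by rewrite big_nseq subr0 iter_mulr_1.
have : perm_eq (ss ++ nseq n 0) (rs ++ nseq m 0).
  apply: prod_XsubC_eq; rewrite !big_cat /= -!Xk.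
  have c0 : lead_coef P != 0 by rewrite lead_coef_eq0.
  by apply: (scalerI c0); rewrite !scalerAl -[in LHS]cE -QE -PE.
move=> /permP /(_ (fun z => z \in (A `\ 0)%classic)).
rewrite !count_cat !count_nseq.
have -> : (0 \in (A `\ 0)%classic) = false.
  by apply/negP => /set_mem [_ /(_ erefl)].
by rewrite !mul0n !addn0.
Qed.

End Roots.

(* Main.v *)
Require Import Defs.
From HB Require Import structures.
From mathcomp Require Import all_boot all_order all_algebra.
From mathcomp Require Import boolp classical_sets reals topology normedtype.
From mathcomp Require Import trigo complex.
From mathcomp Require Import ring lra.

Set Implicit Arguments.
Unset Strict Implicit.
Unset Printing Implicit Defensive.

Import Order.TTheory GRing.Theory Num.Theory.
Import numFieldNormedType.Exports.
Local Open Scope ring_scope.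

(** On the arc of the [t = e^(i x)] with [0 <= x < 2 pi / 3], the reduced Burau
matrices preserve a positive definite Hermitian form found by Squier, so
[B_t(w)] is conjugate to a unitary matrix. Put [n = #w]. Its determinant is
[(- t)^n = s^2] with [s = e^(i n (x + pi) / 2)], and unitarity makes
[s^* tr B_t(w)] a real number between [-2] and [2]. Since
[det (B - I) = det B - tr B + 1], the function

  [f x = s^* det (B_t(w) - I) = 2 cos (n (x + pi) / 2) - s^* tr B_t(w)]

is real. At the nodes, the [x] at which [n (x + pi) / 2] is a multiple
[(+/-) j pi] of [pi], the cosine dominates: [f] has the weak sign [(-1)^j]
([twisted_node]). Consecutive nodes are [2 pi / |n|] apart, so
[[theta1, theta2)] contains nodes separated by at least
[|n| (theta2 - theta1) / (2 pi) - 2] gaps, and the intermediate value theorem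
puts a zero of [f] in each closed gap ([twisted_zero_between]).

Two neighbouring gaps may share a zero, but only at their common node. There
[s = (+/-) 1], and [f = 0] says that a unitary matrix of determinant 1 has
trace 2, hence is the identity ([squier_trace]). All entries of [B(w) - I] then
vanish at [t], so the determinant vanishes to order two and the shared zero
counts twice. The lemma [gap_points] turns this into a count with
multiplicities.

The Alexander polynomial is [det (B_t(w) - I)] divided by [t^2 + t + 1], up to
a unit. That divisor equals [t (1 + 2 cos x)], and [1 + 2 cos x] is positive on
the half-open arc, so up to a phase, which [twisted] corrects, and a real factor
of constant sign the Alexander polynomial takes the values of [f]; the nodes are
chosen strictly below [theta2] to stay inside this arc. *)

(** * Two by two matrices *)

Lemma mx2_eta (K : pzRingType) (M : 'M[K]_2) :
  M = mx2 (M 0 0) (M 0 1) (M 1 0) (M 1 1).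
Proof.
apply/matrixP => i j; rewrite !mxE.
by case: i j => [[|[|//]] ?] [[|[|//]] ?] /=; congr (M _ _); apply: val_inj.
Qed.

Lemma mxtrace_mx2 (K : pzRingType) (a b c d : K) : \tr (mx2 a b c d) = a + d.
Proof. by rewrite /mxtrace big_ord_recl big_ord1 !mxE. Qed.

Lemma scalar_mx2 (K : pzRingType) (a : K) : a%:M = mx2 a 0 0 a.
Proof.
apply/matrixP => i j; rewrite !mxE.
by case: i j => [[|[|//]] ?] [[|[|//]] ?] /=; rewrite ?mulr1n ?mulr0n.
Qed.

Lemma add_mx2 (K : pzRingType) (a b c d a' b' c' d' : K) :
  mx2 a b c d + mx2 a' b' c' d' = mx2 (a + a') (b + b') (c + c') (d + d').
Proof. by apply/matrixP => i j; rewrite !mxE; case: eqP; case: eqP. Qed.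

Lemma opp_mx2 (K : pzRingType) (a b c d : K) :
  - mx2 a b c d = mx2 (- a) (- b) (- c) (- d).
Proof. by apply/matrixP => i j; rewrite !mxE; case: eqP; case: eqP. Qed.

Lemma map_mx2 (K L : pzRingType) (f : K -> L) (a b c d : K) :
  map_mx f (mx2 a b c d) = mx2 (f a) (f b) (f c) (f d).
Proof. by apply/matrixP => i j; rewrite !mxE; case: eqP; case: eqP. Qed.

Lemma det_sub1_mx2 (K : comPzRingType) (M : 'M[K]_2) :
  \det (M - 1%:M) = \det M - \tr M + 1.
Proof.
rewrite [M]mx2_eta scalar_mx2 opp_mx2 add_mx2 !det_mx2 mxtrace_mx2.
ring.
Qed.

Lemma cayley_hamilton_mx2 (K : comPzRingType) (M : 'M[K]_2) :
  M *m M = \tr M *: M - (\det M)%:M.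
Proof.
rewrite [M]mx2_eta scalar_mx2 opp_mx2 -mul_scalar_mx scalar_mx2 !mulmx_mx2 add_mx2.
rewrite det_mx2 mxtrace_mx2.
congr mx2; ring.
Qed.

(** * Squier's Hermitian form *)

Section Squier.
Variable C : numClosedFieldType.
Implicit Types (M N H : 'M[C]_2) (t s : C).

Definition ctrmx M := map_mx Num.conj M^T.

Definition preserves H M := ctrmx M *m H *m M = H.

Lemma ctrmxM M N : ctrmx (M *m N) = ctrmx N *m ctrmx M.
Proof. by rewrite /ctrmx trmx_mul map_mxM. Qed.

Lemma ctrmx_mx2 a b c d : ctrmx (mx2 a b c d) = mx2 a^* c^* b^* d^*.
Proof. by apply/matrixP => i j; rewrite !mxE; case: eqP; case: eqP. Qed.

Lemma preserves1 H : preserves H 1%:M.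
Proof. by rewrite /preserves /ctrmx trmx1 map_mx1 mul1mx mulmx1. Qed.

Lemma preservesM H M N : preserves H M -> preserves H N -> preserves H (M *m N).
Proof.
rewrite /preserves ctrmxM => HM HN.
by rewrite -!mulmxA (mulmxA (ctrmx M)) (mulmxA (_ *m H)) HM mulmxA.
Qed.

Lemma preserves_inv H M N : M *m N = 1%:M -> preserves H M -> preserves H N.
Proof.
move=> MN HM; rewrite /preserves -{1}HM -!mulmxA MN mulmx1 mulmxA -ctrmxM MN.
by rewrite /ctrmx trmx1 map_mx1 mul1mx.
Qed.

(** This form makes the fixed vector of each Burau generator orthogonal to its
eigenvector for the eigenvalue [- t]; when [1 + t != 0], that determines it up
to a factor. *)
Definition squier t := let a := (1 + t) * (1 + t^*) in
  mx2 a (- (1 + t^*)) (- (1 + t)) a.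

Lemma squier_burau1 t : t * t^* = 1 -> preserves (squier t) (mx2 (- t) 1 0 1).
Proof.
move=> tt; rewrite /preserves ctrmx_mx2 !mulmx_mx2 /squier.
by rewrite rmorphN rmorph1 rmorph0; congr mx2; ring: tt.
Qed.

Lemma squier_burau2 t : t * t^* = 1 -> preserves (squier t) (mx2 1 0 t (- t)).
Proof.
move=> tt; rewrite /preserves ctrmx_mx2 !mulmx_mx2 /squier.
by rewrite rmorphN rmorph1 rmorph0; congr mx2; ring: tt.
Qed.

(** The determinant of the form is [a (a - 1)], so it is positive definite as
soon as [1 < a]; this is evaluated on the vector [(x, y)]. *)
Lemma squier_ge0 t x y : let a := (1 + t) * (1 + t^*) in
  t * t^* = 1 -> 1 < a ->
  let h := (ctrmx (mx2 x 0 y 0) *m squier t *m mx2 x 0 y 0) 0 0 in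
  0 <= h /\ (h = 0 -> x = 0 /\ y = 0).
Proof.
move=> a tt a1 h.
have a0 : 0 < a by apply: lt_trans a1.
(* completing the square in [x] *)
have hE : a * h = (a * x - (1 + t^*) * y) * (a * x - (1 + t^*) * y)^* +
            a * (a - 1) * (y * y^*).
  have ac : a^* = a by rewrite /a rmorphM !rmorphD rmorph1 /= conjCK mulrC.
  have aE : a = (1 + t) * (1 + t^*) by [].
  rewrite /h /squier -aE; move: a ac aE {a0 a1 h} => a ac aE.
  rewrite ctrmx_mx2 !mulmx_mx2 !mxE /=.
  rewrite rmorphB !rmorphM rmorphD rmorph1 /= ac conjCK ?rmorph0.
  by ring: aE.
rewrite -!normCK in hE; clearbody a h.
have p1 : 0 <= `|a * x - (1 + t^*) * y| ^+ 2 by rewrite exprn_ge0.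
have p2 : 0 <= a * (a - 1) * `|y| ^+ 2.
  by rewrite mulr_ge0 ?exprn_ge0 // mulr_ge0 ?subr_ge0 ?ltW.
split; first by rewrite -(pmulr_rge0 _ a0) hE addr_ge0.
move=> h0; move: hE; rewrite h0 mulr0 => /esym/eqP; rewrite paddr_eq0 //.
rewrite expf_eq0 normr_eq0 (mulf_eq0 (a * _)) (mulf_eq0 a) (gt_eqF a0) (subr_eq0 a).
rewrite (gt_eqF a1) expf_eq0 normr_eq0 /=.
case/andP=> axy /eqP y0; move: axy.
by rewrite y0 mulr0 subr0 mulf_eq0 (gt_eqF a0) /= => /eqP.
Qed.

(** Reading the diagonal entries of the equation as squared lengths of the
columns of [N]. *)
Lemma squier_scaled_norm t N r : let a := (1 + t) * (1 + t^*) in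
  t * t^* = 1 -> 1 < a -> ctrmx N *m squier t *m N = r *: squier t ->
  0 <= r /\ (r = 0 -> N = 0).
Proof.
move=> a tt a1 HN.
have a0 : 0 < a by apply: lt_trans a1.
have hE i : (ctrmx (mx2 (N 0 i) 0 (N 1 i) 0) *m squier t *m
   mx2 (N 0 i) 0 (N 1 i) 0) 0 0 = r * a.
  transitivity ((r *: squier t) i i).
    rewrite -HN [N in RHS]mx2_eta !ctrmx_mx2 !mulmx_mx2 !mxE.
    by case: i => [[|[|//]] ?] /=;
      rewrite ?rmorph0; congr (_ * _ + _ * _); rewrite ?addr0;
      do ?congr (_ + _); do ?congr (_ * _); do ?congr (Num.conj _);
      congr (N _ _); apply: val_inj.
  by rewrite !mxE; case: i => [[|[|//]] ?].
split=> [|r0].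
  by rewrite -(pmulr_lge0 _ a0) -(hE 0); case: (squier_ge0 (N 0 0) (N 1 0) tt a1).
have col0 i : N 0 i = 0 /\ N 1 i = 0.
  by have [_] := squier_ge0 (N 0 i) (N 1 i) tt a1; apply; rewrite hE r0 mul0r.
rewrite [N]mx2_eta; case: (col0 0) => -> ->; case: (col0 1) => -> ->.
by apply/matrixP => i j; rewrite !mxE; case: eqP; case: eqP.
Qed.

(** For a unitary [M] the eigenvalues are conjugate up to the factor [s], whence
the bound on the trace and the equality case. Eigenvalues are avoided through
the identity [(M - s)^* H (M - s) = (2 - s^* tr M) H], which follows from
Cayley-Hamilton. In the order of [C], the inequality also says that
[s^* * \tr M] is real. *)
Lemma squier_trace t M s : let a := (1 + t) * (1 + t^*) in
  t * t^* = 1 -> 1 < a -> preserves (squier t) M ->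
  s * s^* = 1 -> \det M = s ^+ 2 ->
  0 <= 2 - s^* * \tr M /\ (2 - s^* * \tr M = 0 -> M = s%:M).
Proof.
move=> a tt a1 HM ss dM.
suff /(squier_scaled_norm tt a1) [r0 r1] :
    ctrmx (M - s%:M) *m squier t *m (M - s%:M) = (2 - s^* * \tr M) *: squier t.
  by split=> // /r1/eqP; rewrite subr_eq0 => /eqP.
have cs : ctrmx (M - s%:M) = ctrmx M - (s^*)%:M.
  by rewrite /ctrmx linearB /= map_mxB tr_scalar_mx map_scalar_mx.
(* [M^* H = H M^-1], with [M^-1 = (tr M - M) / det M] *)
have MH : ctrmx M *m squier t = (s^* ^+ 2) *: (\tr M *: squier t - squier t *m M).
  have : ctrmx M *m squier t *m (M *m M) = squier t *m M by rewrite mulmxA HM.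
  rewrite cayley_hamilton_mx2 mulmxBr -scalemxAr HM mul_mx_scalar dM => <-.
  by rewrite opprB addrC subrK scalerA -exprMn mulrC ss expr1n scale1r.
rewrite cs !(mulmxBl, mulmxBr) HM !mul_mx_scalar !mul_scalar_mx MH -scalemxAl.
rewrite !scalerBr !scalerA scalerBl scaler_nat.
have -> : s * s^* ^+ 2 = s^* by rewrite expr2 mulrA ss mul1r.
by rewrite ss scale1r !opprB addrACA addKr mulr2n.
Qed.
End Squier.

(** * Evaluation and order of vanishing of Laurent polynomials *)

Definition represents (f : laurent) (n : nat) (p : {poly int}) : Prop :=
  val f * fracX ^+ n = tofrac p.

Lemma representsP f : exists n p, represents f n p.
Proof. by have /asboolP := laurent_valP f. Qed.

Lemma representsB f g n m p q : represents f n p -> represents g m q ->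
  represents (f - g) (n + m) (p * 'X^m - q * 'X^n).
Proof.
rewrite /represents => fp gq.
rewrite tofracB !tofracM !tofracXn -fp -gq rmorphB mulrBl exprD mulrA.
by rewrite (mulrC (fracX ^+ n)) mulrA.
Qed.

Lemma representsM f g n m p q : represents f n p -> represents g m q ->
  represents (f * g) (n + m) (p * q).
Proof.
rewrite /represents => fp gq.
by rewrite tofracM -fp -gq rmorphM exprD mulrACA.
Qed.

Lemma representsX k : represents (laurentX ^+ k) 0 'X^k.
Proof. by rewrite /represents mulr1 rmorphXn /= tofracXn. Qed.

Lemma represents_uniq f n m p q : represents f n p -> represents f m q ->
  p * 'X^m = q * 'X^n.
Proof.
rewrite /represents => fp fq; apply/eqP.
by rewrite -tofrac_eq !tofracM !tofracXn -fp -fq mulrAC.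
Qed.

Section Evaluation.
Variables (K : fieldType) (z : K).

Definition map_int_poly (p : {poly int}) : {poly K} := map_poly intr p.

(** The proof that [z] is nonzero is an argument, so that the ring morphism
structure below can be inferred from the term alone. *)
Definition laurent_eval of z != 0 := fun f : laurent =>
  let np := xget (0%N, 0) [set np | represents f np.1 np.2] in
  (map_int_poly np.2).[z] / z ^+ np.1.

Hypothesis z0 : z != 0.
Local Notation ev := (laurent_eval z0).

Lemma laurent_evalE f n p :
  represents f n p -> ev f = (map_int_poly p).[z] / z ^+ n.
Proof.
move=> fp; rewrite /laurent_eval; case: xgetP => [[m q] _ /= fq|/(_ (n, p))]; last first.
  by case.
have := congr1 (fun p : {poly int} => (map_int_poly p).[z]) (represents_uniq fp fq).
rewrite /= /map_int_poly !rmorphM /= !map_polyXn !hornerE ?hornerXn => pq.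
apply/eqP; rewrite eqr_div ?expf_neq0 //; exact/eqP.
Qed.

Lemma laurent_eval_is_zmod_morphism : zmod_morphism ev.
Proof.
move=> f g; have [n [p fp]] := representsP f; have [m [q gq]] := representsP g.
rewrite (laurent_evalE fp) (laurent_evalE gq).
rewrite (laurent_evalE (representsB fp gq)).
rewrite /map_int_poly rmorphB !rmorphM /= !map_polyXn !hornerE ?hornerXn exprD.
have := expf_neq0 n z0; have := expf_neq0 m z0.
move: (z ^+ n) (z ^+ m) => u v u0 v0.
by field; rewrite u0 v0.
Qed.

Lemma laurent_eval_is_monoid_morphism : monoid_morphism ev.
Proof.
split=> [|f g].
  rewrite (laurent_evalE (representsX 0)).
  by rewrite /map_int_poly rmorph1 hornerC expr0 divr1.
have [n [p fp]] := representsP f; have [m [q gq]] := representsP g.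
rewrite (laurent_evalE fp) (laurent_evalE gq).
rewrite (laurent_evalE (representsM fp gq)).
by rewrite /map_int_poly rmorphM /= hornerM exprD invfM mulrACA.
Qed.

HB.instance Definition _ :=
  GRing.isZmodMorphism.Build laurent K ev laurent_eval_is_zmod_morphism.
HB.instance Definition _ :=
  GRing.isMonoidMorphism.Build laurent K ev laurent_eval_is_monoid_morphism.

Lemma laurent_evalX : ev laurentX = z.
Proof.
by rewrite (laurent_evalE (representsX 1)) /map_int_poly map_polyX hornerX divr1.
Qed.

(** Vanishing at [z] to order at least [k]. *)
Definition vanishes k f := exists n p, represents f n p /\ ('X - z%:P) ^+ k %| map_int_poly p.

Lemma vanishes_eval f : ev f = 0 -> vanishes 1 f.
Proof.
have [n [p fp]] := representsP f; rewrite (laurent_evalE fp) => /eqP.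
rewrite mulf_eq0 invr_eq0 expf_eq0 (negPf z0) andbF orbF => pz.
by exists n, p; rewrite expr1 dvdp_XsubCl.
Qed.

Lemma vanishesM j k f g : vanishes j f -> vanishes k g -> vanishes (j + k) (f * g).
Proof.
move=> [n [p [fp dp]]] [m [q [gq dq]]]; exists (n + m)%N, (p * q).
by split; [exact: representsM | rewrite /map_int_poly rmorphM exprD dvdp_mul].
Qed.

Lemma vanishesB k f g : vanishes k f -> vanishes k g -> vanishes k (f - g).
Proof.
move=> [n [p [fp dp]]] [m [q [gq dq]]]; exists (n + m)%N, (p * 'X^m - q * 'X^n).
split; first exact: representsB.
by rewrite /map_int_poly rmorphB !rmorphM dvdp_sub // dvdp_mulr.
Qed.

(** Neither a factor [g] nor a power of [t] can account for any of the zero of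
[f * g], because both are nonzero at [z]. *)
Lemma vanishes_represents k f g n p : ev g != 0 ->
  vanishes k (f * g) -> represents f n p -> ('X - z%:P) ^+ k %| map_int_poly p.
Proof.
move=> gz [m [q [fgq dq]]] fp; have [l [r gr]] := representsP g.
have := represents_uniq (representsM fp gr) fgq.
move/(congr1 map_int_poly); rewrite /map_int_poly !rmorphM /= !map_polyXn.
rewrite -/(map_int_poly _) => pq.
have : ('X - z%:P) ^+ k %| map_int_poly p * (map_int_poly r * 'X^m).
  by rewrite mulrA pq dvdp_mulr.
rewrite Gauss_dvdpl // coprimep_expl // coprimep_sym coprimep_XsubC rootE !hornerE.
rewrite ?hornerXn mulf_neq0 ?expf_neq0 //.
apply: contraNneq gz => rz.
by rewrite (laurent_evalE gr) -/(map_int_poly r) rz mul0r.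
Qed.
End Evaluation.

(** * The Burau representation at a complex number *)

Lemma det_burau w : \det (burau w) = (- laurentX) ^ expsum w.
Proof.
have XU : - laurentX \is a GRing.unit by rewrite unitrN laurentX_unit.
rewrite /burau /expsum /word_burau /word_expsum.
elim: (br3_repr w) => [|a u IH]; first by rewrite !big_nil det1 expr0z.
rewrite !big_cons -mulmxE det_mulmx IH exprzDr //; congr (_ * _).
case: a => i e; rewrite /burau_letter /=.
have dB : \det (if i then burau2 else burau1) = - laurentX.
  by case: i; rewrite det_mx2; ring.
by case: e; rewrite ?det_inv dB ?exprN1 ?expr1z.
Qed.

Section BurauEval.
Variables (C : numClosedFieldType) (t : C) (t0 : t != 0).
Local Notation ev := (laurent_eval t0).

Definition burau_at w : 'M[C]_2 := map_mx ev (burau w).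

Lemma burau_at_squier w : t * t^* = 1 -> preserves (squier t) (burau_at w).
Proof.
move=> tt; rewrite /burau_at /burau /word_burau.
elim/big_rec: _ => [|a B _ HB]; first by rewrite map_mx1; exact: preserves1.
rewrite -mulmxE map_mxM; apply: preservesM => //.
case: a => i e; rewrite /burau_letter /=.
set L := if i then burau2 else burau1.
have HL : preserves (squier t) (map_mx ev L).
  rewrite /L; case: i {L}; rewrite map_mx2 rmorphN rmorph0 rmorph1 /= laurent_evalX.
  - exact: squier_burau2.
  - exact: squier_burau1.
case: e => //; apply: preserves_inv HL; rewrite -map_mxM mulmxV ?map_mx1 //.
by rewrite /L; case: (i); [exact: burau2_unit | exact: burau1_unit].
Qed.

Lemma det_burau_at w : \det (burau_at w) = (- t) ^ expsum w.
Proof.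
have XU : - laurentX \is a GRing.unit by rewrite unitrN laurentX_unit.
by rewrite det_map_mx det_burau /= rmorphXz // rmorphN /= laurent_evalX.
Qed.

(* [f] is meant to be the Alexander polynomial and [g] is [t^2 + t + 1], up to
   a unit. *)
Variables (w : Br3) (f g : laurent).
Hypothesis fg : f * g = \det (burau w - 1%:M).

Lemma factor_at : ev f * ev g = \det (burau_at w - 1%:M).
Proof. by rewrite -rmorphM fg -(map_mx1 ev) -map_mxB det_map_mx. Qed.

(** If [B_t(w) = I], then each entry of [B(w) - I] has a zero at [t], and the
determinant, being quadratic in the entries, has a double zero. *)
Lemma factor_double_root n p : ev g != 0 ->
  burau_at w = 1%:M -> represents f n p -> ('X - t%:P) ^+ 2 %| map_int_poly C p.
Proof.
move=> gt0 B1; apply: (vanishes_represents gt0); rewrite fg.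
have B0 i j : vanishes t 1 ((burau w - 1%:M) i j).
  apply: (@vanishes_eval _ _ t0).
  have := congr1 (fun A : 'M_2 => A i j) B1.
  by rewrite !mxE rmorphB /= => ->; rewrite rmorph_nat subrr.
by rewrite [burau w - _]mx2_eta det_mx2; apply: vanishesB; apply: (@vanishesM _ _ 1 1).
Qed.
End BurauEval.

Lemma closure_alexander_factor w D : is_alexander_of_closure w D ->
  exists (b : bool) (k : int),
    D * ((-1) ^+ b * laurentX ^ k * (laurentX ^+ 2 + laurentX + 1)) =
      \det (burau w - 1%:M).
Proof.
move=> [b [k ->]]; exists b, (- k); rewrite -alexanderE.
have e : laurentX ^ k * laurentX ^ (- k) = 1.
  by rewrite -exprzDr ?laurentX_unit // subrr expr0z.
have e' : (-1) ^+ b * (-1) ^+ b = 1 :> laurent by rewrite -expr2 sqrr_sign.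
move: (laurentX ^ k) (laurentX ^ (- k)) ((-1) ^+ b) e e' => x y c xy cc.
by ring: xy cc.
Qed.

(** * The unit circle *)

Section Cis.
Variable R : realType.
Implicit Types (x y : R).

Definition cis x : R[i] := (cos x +i* sin x)%C.

Lemma cisD x y : cis (x + y) = cis x * cis y.
Proof. by rewrite /cis cosD sinD; simpc; congr Complex; rewrite addrC. Qed.

Lemma cis0 : cis 0 = 1.
Proof. by rewrite /cis cos0 sin0. Qed.

Lemma conj_cis x : (cis x)^* = cis (- x).
Proof. by rewrite /cis cosN sinN. Qed.

Lemma cis_conj x : cis x * (cis x)^* = 1.
Proof. by rewrite conj_cis -cisD subrr cis0. Qed.

Lemma cis_neq0 x : cis x != 0.
Proof. by apply/eqP => h; have /eqP := cis_conj x; rewrite h mul0r eq_sym oner_eq0. Qed.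

Lemma cisDpi x : cis (x + pi) = - cis x.
Proof. by rewrite /cis cosDpi sinDpi. Qed.

Lemma cisXn x n : cis x ^+ n = cis (n%:R * x).
Proof.
elim: n => [|n IH]; first by rewrite mul0r cis0.
by rewrite exprS IH -cisD -natr1 mulrDl mul1r addrC.
Qed.

Lemma cisV x : (cis x)^-1 = cis (- x).
Proof. by rewrite -[LHS]mulr1 -(cis_conj x) mulKf ?cis_neq0 // conj_cis. Qed.

Lemma cisXz x (n : int) : cis x ^ n = cis (n%:~R * x).
Proof.
case: n => n; first exact: cisXn.
by rewrite NegzE -exprnN cisXn cisV mulrNz mulNr.
Qed.

Lemma cis_natpi n : cis (n%:R * pi) = (-1) ^+ n.
Proof. by rewrite -cisXn -[pi]add0r cisDpi cis0. Qed.

Lemma cis_inj x y : 0 <= x <= pi -> 0 <= y <= pi -> cis x = cis y -> x = y.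
Proof. by move=> xI yI [c _]; apply: cos_inj; rewrite ?in_itv. Qed.

(** This holds because [cos (2 pi / 3) = - 1 / 2], by the triple angle formula:
[4 c^3 - 3 c - 1 = (c - 1) (2 c + 1)^2]. *)
Lemma cos_gt_mhalf x : 0 <= x -> x < 2 * pi / 3 -> 0 < 1 + 2 * cos x.
Proof.
move=> x0 xp; have pi0 := pi_gt0 R.
pose y : R := 2 * pi / 3.
have c3 : cos (y + y + y) = 1.
  have -> : y + y + y = pi + pi by rewrite /y; field.
  by rewrite cosDpi cospi opprK.
have cy : cos y < 1.
  by rewrite -(cos0 R) ltr_cos ?in_itv /=; rewrite /y; lra.
have cyE : 1 + 2 * cos y = 0.
  move: c3; rewrite !cosD sinD => c3.
  have cs : cos y * (cos y ^+ 2 + sin y ^+ 2) = cos y by rewrite cos2Dsin2 mulr1.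
  have : (cos y - 1) * (1 + 2 * cos y) ^+ 2 = 0 by lra.
  by move/eqP; rewrite mulf_eq0 expf_eq0 subr_eq0 (lt_eqF cy) => /eqP.
have : cos y < cos x by rewrite ltr_cos ?in_itv /=; rewrite /y; lra.
move: cyE; lra.
Qed.

Lemma cis_norm_sum x : (1 + cis x) * (1 + (cis x)^*) = (1 + (1 + 2 * cos x))%:C%C.
Proof.
rewrite conj_cis /cis cosN sinN; simpc; have := cos2Dsin2 x.
move=> e; congr Complex; lra.
Qed.

Lemma cis_cyclotomic x : cis x ^+ 2 + cis x + 1 = cis x * (1 + 2 * cos x)%:C%C.
Proof.
rewrite expr2 /cis; simpc; have := cos2Dsin2 x.
move=> e; congr Complex; lra.
Qed.
End Cis.

Section ComplexContinuity.
Variable R : realType.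
Implicit Types f g : R -> R[i].

(** Continuity by real and imaginary parts, which is what the intermediate value
theorem for the real part of a complex function consumes. *)
Definition ccontinuous f :=
  continuous (fun x => complex.Re (f x)) /\ continuous (fun x => complex.Im (f x)).

Lemma ccontinuous_cst c : ccontinuous (fun=> c).
Proof. by split=> x; apply: cvg_cst. Qed.

Lemma ccontinuousD f g :
  ccontinuous f -> ccontinuous g -> ccontinuous (fun x => f x + g x).
Proof.
move=> [fr fi] [gr gi]; split.
- rewrite (_ : (fun x => complex.Re (f x + g x)) =
      (fun x => complex.Re (f x) + complex.Re (g x))); last first.
    by apply/funext => x /=; case: (f x); case: (g x).
  by move=> x; apply: cvgD; [exact: fr | exact: gr].
- rewrite (_ : (fun x => complex.Im (f x + g x)) =
      (fun x => complex.Im (f x) + complex.Im (g x))); last first.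
    by apply/funext => x /=; case: (f x); case: (g x).
  by move=> x; apply: cvgD; [exact: fi | exact: gi].
Qed.

Lemma ccontinuousM f g :
  ccontinuous f -> ccontinuous g -> ccontinuous (fun x => f x * g x).
Proof.
move=> [fr fi] [gr gi]; split.
- rewrite (_ : (fun x => complex.Re (f x * g x)) =
      (fun x => complex.Re (f x) * complex.Re (g x) - complex.Im (f x) * complex.Im (g x))); last first.
    by apply/funext => x /=; case: (f x); case: (g x).
  move=> x; apply: cvgB; apply: cvgM.
  + exact: fr. + exact: gr. + exact: fi. + exact: gi.
- rewrite (_ : (fun x => complex.Im (f x * g x)) =
      (fun x => complex.Re (f x) * complex.Im (g x) + complex.Im (f x) * complex.Re (g x))); last first.
    by apply/funext => x /=; case: (f x); case: (g x).
  move=> x; apply: cvgD; apply: cvgM.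
  + exact: fr. + exact: gi. + exact: fi. + exact: gr.
Qed.

Lemma ccontinuous_cis (a c : R) : ccontinuous (fun x => cis (a * x + c)).
Proof.
have aff : continuous (fun x : R => a * x + c).
  by move=> x; apply: cvgD; [apply: cvgM; [exact: cvg_cst | exact: cvg_id] | exact: cvg_cst].
split.
- change (continuous (@cos R \o (fun x => a * x + c))) => x.
  by apply: continuous_comp; [exact: aff | exact: continuous_cos].
- change (continuous (@sin R \o (fun x => a * x + c))) => x.
  by apply: continuous_comp; [exact: aff | exact: continuous_sin].
Qed.

Lemma ccontinuous_horner_cis (q : {poly R[i]}) : ccontinuous (fun x => q.[cis x]).
Proof.
elim/poly_ind: q => [|q c IH].
  by rewrite (_ : (fun x => _) = (fun=> 0));
    [exact: ccontinuous_cst | apply/funext => x; rewrite horner0].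
rewrite (_ : (fun x => _) = (fun x => q.[cis x] * cis (1 * x + 0) + c)); last first.
  by apply/funext => x; rewrite !hornerE.
apply: ccontinuousD; last exact: ccontinuous_cst.
by apply: ccontinuousM => //; exact: ccontinuous_cis.
Qed.
End ComplexContinuity.

(** * The real function whose zeros are counted *)

Section Closure.
Variables (R : realType) (w : Br3) (D : laurent) (b : bool) (k : int).
Variables (n : nat) (p : {poly int}).
Hypothesis DE : D * ((-1) ^+ b * laurentX ^ k * (laurentX ^+ 2 + laurentX + 1)) =
  \det (burau w - 1%:M).
Hypothesis Dp : represents D n p.
Local Notation N := ((expsum w)%:~R : R).
Local Notation P := (map_int_poly R[i] p).
Implicit Type x : R.

Definition burau_arc x := burau_at (cis_neq0 x) w.

Definition sqrt_det x : R[i] := cis (N * ((x + pi) / 2)).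

(** The values of [P] on the circle, multiplied by the phase that makes them
real; see [twistedE]. *)
Definition twisted x : R[i] :=
  cis ((k%:~R + 1 - n%:R - N / 2) * x + - (N * (pi / 2))) * P.[cis x].

Lemma det_burau_arc x : \det (burau_arc x) = sqrt_det x ^+ 2.
Proof.
rewrite det_burau_at -cisDpi cisXz cisXn; congr cis.
by field.
Qed.

Lemma twistedE x :
  twisted x * ((-1) ^+ b * (1 + 2 * cos x)%:C%C) =
  (sqrt_det x)^* * \det (burau_arc x - 1%:M).
Proof.
rewrite -(factor_at (cis_neq0 x) DE) (laurent_evalE _ Dp) !rmorphM rmorph_sign.
rewrite rmorphXz ?laurentX_unit //= !rmorphD rmorphXn rmorph1 /= laurent_evalX.
rewrite cis_cyclotomic /twisted /sqrt_det conj_cis cisXz cisXn cisV.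
set a := (k%:~R + _ - _ - _) * x + _.
have -> : a = - (N * ((x + pi) / 2)) + k%:~R * x + x - n%:R * x.
  by rewrite /a; field.
by rewrite !cisD; ring.
Qed.

Lemma ccontinuous_twisted : ccontinuous twisted.
Proof.
by apply: ccontinuousM; [exact: ccontinuous_cis | exact: ccontinuous_horner_cis].
Qed.

Section Arc.
Variable x : R.
Hypotheses (x0 : 0 <= x) (x_lt : x < 2 * pi / 3).

Lemma norm1D_cis_gt1 : 1 < (1 + cis x) * (1 + (cis x)^*).
Proof. by rewrite cis_norm_sum ltcR ltrDl cos_gt_mhalf. Qed.

(** By [twistedE], this number is [s + s^* - s^* tr B] up to a real factor; the
last term is real by [squier_trace]. *)
Lemma twisted_real : (complex.Re (twisted x))%:C%C = twisted x.
Proof.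
apply: RRe_real.
have c0 : (-1) ^+ b * (1 + 2 * cos x)%:C%C != 0 :> R[i].
  by rewrite mulf_neq0 ?signr_eq0 // eq_sym lt_eqF // ltcR cos_gt_mhalf.
have [h _] := squier_trace (cis_conj x) norm1D_cis_gt1
  (burau_at_squier (cis_neq0 x) w (cis_conj x)) (cis_conj _) (det_burau_arc x).
rewrite -[twisted x](mulfK c0) twistedE; apply: realM; last first.
  by rewrite realV; apply: realM; [rewrite rpredX ?rpredN1 | rewrite complex_real].
rewrite det_sub1_mx2 det_burau_arc.
have e (s T : R[i]) : s * s^* = 1 ->
     s^* * (s ^+ 2 - T + 1) = (2 - s^* * T) + (s + s^* - 2).
  by move=> ss; ring: ss.
rewrite (e _ _ (cis_conj _)); apply: realD; first exact: ger0_real.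
apply: realB; last exact: realn.
by rewrite conj_cis /sqrt_det /cis cosN sinN; simpc; rewrite complex_real.
Qed.

(** Here [s = (-1)^j], so [s^* det (B - I) = (-1)^j (2 - tr B)], and [det B = 1]
allows [squier_trace] to be applied with the square root [1] of [det B]
instead of [s]: the sign and the equality case [B = I] are read off from it. *)
Lemma twisted_node (j : nat) : sqrt_det x = (-1) ^+ j ->
  0 <= (-1) ^+ j * ((-1) ^+ b * complex.Re (twisted x)) /\
  (twisted x = 0 -> ('X - (cis x)%:P) ^+ 2 %| P).
Proof.
move=> sj.
have dB : \det (burau_arc x) = 1 ^+ 2 by rewrite det_burau_arc sj sqrr_sign expr1n.
have one : 1 * 1^* = 1 :> R[i] by rewrite conjC1 mul1r.
have [h h0] := squier_trace (cis_conj x) norm1D_cis_gt1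
  (burau_at_squier (cis_neq0 x) w (cis_conj x)) one dB.
rewrite conjC1 mul1r in h h0.
have c0 : 0 < 1 + 2 * cos x by exact: cos_gt_mhalf.
have := twistedE x; rewrite sj rmorph_sign det_sub1_mx2 dB expr1n.
rewrite addrAC -[1 + 1]/(2%:R : R[i]) => tE.
split=> [|t0].
  have : 0 <= (-1) ^+ j * (-1) ^+ b * twisted x * (1 + 2 * cos x)%:C%C.
    have -> : (-1) ^+ j * (-1) ^+ b * twisted x * (1 + 2 * cos x)%:C%C =
       (-1) ^+ j * (twisted x * ((-1) ^+ b * (1 + 2 * cos x)%:C%C)) by ring.
    by rewrite tE mulrA -expr2 sqrr_sign mul1r.
  rewrite pmulr_lge0 ?ltcR // -twisted_real.
  by rewrite -!(rmorph_sign (real_complex R)) -!rmorphM /= lecR mulrA.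
have g0 : laurent_eval (cis_neq0 x) ((-1) ^+ b * laurentX ^ k * (laurentX ^+ 2 + laurentX + 1)) != 0.
  rewrite !rmorphM rmorph_sign rmorphXz ?laurentX_unit //= !rmorphD rmorphXn rmorph1 /=.
  rewrite laurent_evalX cis_cyclotomic !mulf_neq0 ?signr_eq0 ?expfz_neq0 ?cis_neq0 //.
  by rewrite eq_sym lt_eqF ?ltcR.
apply: (factor_double_root DE g0 _ Dp); apply: h0.
move: tE; rewrite t0 mul0r => /esym/eqP; rewrite mulf_eq0 signr_eq0 => /eqP.
by [].
Qed.
End Arc.

Lemma twisted_zero_between x y (j : nat) :
  0 <= x -> x <= y -> y < 2 * pi / 3 ->
  sqrt_det x = (-1) ^+ j -> sqrt_det y = (-1) ^+ j.+1 ->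
  exists2 z, x <= z <= y & root P (cis z).
Proof.
move=> x0 xy y_lt sx sy.
have [h1 _] := twisted_node x0 (le_lt_trans xy y_lt) sx.
have [h2 _] := twisted_node (le_trans x0 xy) y_lt sy.
pose F (u : R) : R := complex.Re (twisted u).
have [] := @IVT R F x y 0 xy.
- by apply: continuous_subspaceT; have [cF _] := ccontinuous_twisted; exact: cF.
- move: h1 h2; rewrite exprS mulN1r mulNr oppr_ge0 !mulrA -signr_odd -signr_addb.
  rewrite -/(F _) -/(F _) ge_min le_max.
  by case: (_ (+) _); rewrite ?mulN1r ?mul1r ?oppr_ge0 ?oppr_le0 => -> ->; rewrite ?orbT.
move=> z; rewrite in_itv /= => zI Fz; exists z => //; case/andP: zI => xz zy.
have := twisted_real (le_trans x0 xz) (le_lt_trans zy y_lt).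
by rewrite [complex.Re _]Fz => /esym/eqP; rewrite mulf_eq0 (negPf (cis_neq0 _)).
Qed.
End Closure.

(** * Counting roots with multiplicity *)

(** One point is chosen in every closed gap. A point can be chosen twice only if
it is the common endpoint of two neighbouring gaps, where [mu] is at least 2. *)
Lemma gap_points d (T : orderType d) (mu : T -> nat) (x : nat -> T) (m : nat) :
  (forall i, (i < m)%N -> (x i < x i.+1)%O) ->
  (forall i, (i < m)%N -> exists2 y, (x i <= y <= x i.+1)%O & (0 < mu y)%N) ->
  (forall i, (i <= m)%N -> (0 < mu (x i))%N -> (1 < mu (x i))%N) ->
  exists s : seq T, [/\ size s = m, all (fun y => x 0%N <= y <= x m)%O s &
    forall z, (count_mem z s <= mu z)%N].
Proof.
move=> x_lt gap node.
(* The last point can have been chosen at most once so far. *)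
suff: exists s : seq T, [/\ size s = m, all (fun y => x 0%N <= y <= x m)%O s,
    forall z, (count_mem z s <= mu z)%N, (count_mem (x m) s <= 1)%N &
    (x 0%N <= x m)%O].
  by case=> s [? ? ? _ _]; exists s.
elim: m x_lt gap node => [|m IH] x_lt gap node; first by exists [::].
case: IH => [i im|i im|i im|s [sz sI smu smx x0m]].
- exact/x_lt/ltnW.
- exact/gap/ltnW.
- exact/node/leqW.
have [y /andP [xy yx] muy] := gap m (ltnSn m).
have xm := x_lt m (ltnSn m).
have cnt0 z : (x m < z)%O -> count_mem z s = 0%N.
  move=> xz; apply/count_memPn/negP => /(allP sI) /andP [_ zx].
  by have := lt_le_trans xz zx; rewrite ltxx.
exists (y :: s); split=> /=.
- by rewrite sz.
- rewrite yx (le_trans x0m xy) /=; apply/allP => z /(allP sI) /andP [-> zx] /=.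
  exact/(le_trans zx)/ltW.
- move=> z; have [<-|_] := eqVneq y z; last exact: smu.
  move: xy; rewrite le_eqVlt => /predU1P [yE|xy]; last by rewrite cnt0.
  rewrite -yE in muy *; apply: leq_trans (node m _ muy) => //.
- by rewrite (cnt0 (x m.+1)) // addn0 leq_b1.
- exact/(le_trans x0m)/ltW.
Qed.

(** This is the ceiling of [a], minus one. With the last node numbered [n], the
strict inequality keeps that node strictly below [theta2]. *)
Lemma nat_below (R : archiRealDomainType) (a : R) : 0 < a ->
  exists2 n : nat, n%:R < a & a <= n.+1%:R.
Proof.
move=> a0; have /andP [h1 h2] := ceil_itv a.
have : 0 < Num.ceil a by rewrite -ceil_gt0 in a0 *.
case: (Num.ceil a) h1 h2 => [[|n]|] // h1 h2 _; exists n => //.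
by move: h1; rewrite -[n.+1]addn1 PoszD addrK.
Qed.

Lemma leq_poly_nroots (R : realType) (A : set R[i]) (P : {poly R[i]}) (s : seq R[i]) :
  P != 0 -> all (fun z => z \in A) s ->
  (forall z, (count_mem z s <= mup z P)%N) -> (size s <= poly_nroots A P)%N.
Proof.
move=> P0 sA smu; have [rs PE] := closed_field_poly_normal P.
rewrite (poly_nrootsE _ P0 PE).
have : forall z, (count_mem z s <= count_mem z rs)%N.
  move=> z; have := smu z; rewrite PE -mul_polyC mupMr ?mu_prod_XsubC //.
  by rewrite rootC lead_coef_eq0.
move/count_subseqP => [s' s'rs ss'].
rewrite (perm_size ss') -(count_predT s').
have <- : count (fun z => z \in A) s' = count predT s'.
  apply: eq_in_count => z; rewrite -(perm_mem ss') => /(allP sA) -> //.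
exact: leq_count_subseq.
Qed.

Theorem corollary5p6 (R : realType) (w : Br3) (Delta : laurent)
    (theta1 theta2 : R) :
  0 <= theta1 -> theta1 < theta2 -> theta2 <= 2 * pi / 3 ->
  is_alexander_of_closure w Delta -> Delta != 0 ->
  (theta2 - theta1) / (2 * pi) * `|expsum w|%:~R - 2
    <= (laurent_nroots (circle_arc theta1 theta2) Delta)%:R.
Proof.
move=> t1 t12 t2 DA D0.
have pi0 := pi_gt0 R.
have [b [k DE]] := closure_alexander_factor DA.
have [n [p Dp]] := representsP Delta.
rewrite (laurent_nrootsE _ D0 Dp) -/(map_int_poly R[i] p).
set P := map_int_poly R[i] p; set A := circle_arc theta1 theta2.
have P0 : P != 0.
  have p0 : p != 0.
    apply: contraNneq D0 => p0; have /eqP := Dp; rewrite p0 tofrac0.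
    by rewrite mulf_eq0 expf_eq0 (negPf fracX_neq0) andbF orbF -(inj_eq val_inj) rmorph0.
  by rewrite map_poly_eq0_id0 // intr_eq0 lead_coef_eq0.
have [N0|N0] := eqVneq (expsum w) 0.
  rewrite N0 normr0 mulr0 sub0r; apply: (@le_trans _ _ 0); last exact: ler0n.
  by rewrite oppr_le0.
(* [L] is the number of nodes per unit length. *)
pose L : R := `|expsum w|%:~R / (2 * pi).
have L0 : 0 < L by rewrite divr_gt0 ?ltr0z ?normr_gt0 // mulr_gt0.
have [n1 n1lt n1ge] := @nat_below R (L * (theta1 + pi)) ltac:(by rewrite mulr_gt0 // ltr_wpDl).
have [n2 n2lt n2ge] := @nat_below R (L * (theta2 + pi)) ltac:(by rewrite mulr_gt0 //; lra).
have bound : (theta2 - theta1) / (2 * pi) * `|expsum w|%:~R - 2 <= (n2 - n1.+1)%:R.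
  have -> : (theta2 - theta1) / (2 * pi) * `|expsum w|%:~R = L * (theta2 + pi) - L * (theta1 + pi).
    by rewrite -mulrBr opprD addrACA subrr addr0 /L [RHS]mulrAC mulrC mulrA.
  have : n2%:R <= (n2 - n1.+1)%:R + n1.+1%:R :> R by rewrite -natrD ler_nat addnC -leq_subLR.
  by move: n2ge; rewrite -![_.+1%:R]natr1; lra.
apply: le_trans bound _; rewrite ler_nat.
have [->//|m0] := posnP (n2 - n1.+1)%N.
have n12 : (n1.+1 <= n2)%N by rewrite ltnW // -subn_gt0.
(* The nodes in [[theta1, theta2)] have the numbers from [n1 + 1] to [n2]. *)
pose x i : R := (n1.+1 + i)%:R / L - pi.
have x_lt i : x i < x i.+1.
  by rewrite /x ltrD2r ltr_pM2r ?invr_gt0 // ltr_nat addnS.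
have x_in i : (i <= n2 - n1.+1)%N -> theta1 <= x i < theta2.
  move=> im; rewrite /x lerBrDr ltrBlDr ler_pdivlMr // ltr_pdivrMr // !(mulrC _ L).
  apply/andP; split; first by apply: (le_trans n1ge); rewrite ler_nat leq_addr.
  apply: le_lt_trans n2lt; rewrite ler_nat.
  by rewrite -(subnKC n12) leq_add2l.
have x_sqrt i : sqrt_det w (x i) = (-1) ^+ (n1.+1 + i).
  rewrite /sqrt_det /x subrK /L.
  have -> : (n1.+1 + i)%:R / (`|expsum w|%:~R / (2 * pi)) / 2 =
     (n1.+1 + i)%:R * pi / `|expsum w|%:~R :> R.
    have a0 : `|expsum w|%:~R != 0 :> R by rewrite intr_eq0 normr_eq0.
    move: (pi : R) (_%:~R : R) (lt0r_neq0 pi0) a0 => q a q0 a0.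
    by field; rewrite a0 q0.
  have N0' : (expsum w)%:~R != 0 :> R by rewrite intr_eq0.
  case: ltrgt0P N0 => // Ns _; rewrite ?mulrNz ?invrN ?mulrN mulrC divfK //.
    exact: cis_natpi.
  by rewrite -conj_cis cis_natpi rmorph_sign.
pose mu y := mup (cis y) P.
have dom y : theta1 <= y < theta2 -> 0 <= y /\ y < 2 * pi / 3.
  by case/andP => h1 h2; split; [apply: le_trans h1 | apply: lt_le_trans t2].
have gap i : (i < n2 - n1.+1)%N -> exists2 y, x i <= y <= x i.+1 & (0 < mu y)%N.
  move=> im.
  have /dom [a1 _] := x_in i (ltnW im); have /dom [_ b2] := x_in i.+1 im.
  have := x_sqrt i.+1; rewrite addnS => si.
  have [y yI Py] := twisted_zero_between DE Dp a1 (ltW (x_lt i)) b2 (x_sqrt i) si.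
  by exists y => //; rewrite /mu -XsubC_dvd // dvdp_XsubCl.
have node i : (i <= n2 - n1.+1)%N -> (0 < mu (x i))%N -> (1 < mu (x i))%N.
  move=> im; have [a1 a2] := dom _ (x_in i im).
  have [_ h] := twisted_node DE Dp a1 a2 (x_sqrt i).
  rewrite /mu -XsubC_dvd // dvdp_XsubCl mup_geq // => /eqP Px; apply: h.
  by rewrite /twisted Px mulr0.
have [s [sz sI smu]] := gap_points (fun i _ => x_lt i) gap node.
have s_in y : y \in s -> theta1 <= y <= theta2.
  move=> /(allP sI) /andP [xy yx].
  have /andP [h _] := x_in 0%N isT; have /andP [_ h'] := x_in _ (leqnn _).
  by rewrite (le_trans h xy) (le_trans yx (ltW h')).
have s_pi y : y \in s -> 0 <= y <= pi.
  by move=> /s_in /andP [h h']; apply/andP; split; lra.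
rewrite -sz -(size_map (@cis R)); apply: leq_poly_nroots => //.
- apply/allP => _ /mapP [y /s_in yI ->]; rewrite inE; split; last exact/eqP/cis_neq0.
  by exists y.
- move=> z; have [/mapP [y ys ->]|/count_memPn ->//] := boolP (z \in map (@cis R) s).
  apply: leq_trans (smu y); rewrite count_map; apply: eq_leq.
  apply: eq_in_count => y' y's /=; apply/eqP/eqP => [|->//].
  by apply: cis_inj; exact: s_pi.
Qed.
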